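(* For $k\geq3$, let $F$ be a complete $k$-partite $k$-graph with $\gcd(F)=1$. Then $\delta_{k-1}(\mathsf{Spa}_F)=\tau(F)$, $\delta_{k-1}(\mathsf{Div}_F)=0$ and $\delta_{k-1}(\mathsf{Cov}_F)=0$.
   Context: A $k$-graph is a $k$-uniform hypergraph on a finite vertex set. It is complete $k$-partite if its vertex set is partitioned into $k$ (non-empty) parts and its edges are exactly the $k$-sets with one vertex in each part. An $\ell$-colouring of the vertices of a $k$-graph is proper if no edge contains more than one vertex of the same colour; $\chi(F)$ is the least $\ell$ for which $F$ has a proper $\ell$-colouring (here $\chi(F)=k$). $\tau(F)$ is the relative size (size divided by $|V(F)|$) of a smallest colour class over all proper $\chi(F)$-colourings of $F$. Let $\mathcal{D}(F)$ be the set of the integers $\big||\phi^{-1}(1)|-|\phi^{-1}(2)|\big|$ over all proper $\chi(F)$-colourings $\phi\colon V(F)\to\{1,\dots,\chi(F)\}$; $\gcd(F)$ is the greatest common divisor of $\mathcal{D}(F)\setminus\{0\}$, with $\gcd(F)=\infty$ if $\mathcal{D}(F)=\{0\}$. $\mathrm{Hom}(F;G)$ is the set of functions $V(F)\to V(G)$ mapping edges of $F$ to edges of $G$. A weighting $w\colon \mathrm{Hom}(F;G)\to\mathbb{R}$ is a perfect $\mathrm{Hom}(F)$-tiling of $G$ if $\sum_{\phi}w(\phi)|\phi^{-1}(v)|=1$ for every $v\in V(G)$; it is fractional (integral) if its values lie in $[0,1]$ (in $\mathbb{Z}$). $G$ is $\mathrm{Hom}(F)$-covered if for every $v\in V(G)$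 there is $\phi\in\mathrm{Hom}(F;G)$ with $|\phi^{-1}(v)|=1$. $\mathsf{Spa}_F$, $\mathsf{Div}_F$, $\mathsf{Cov}_F$ denote the sets of $k$-graphs that have a perfect fractional $\mathrm{Hom}(F)$-tiling, have a perfect integral $\mathrm{Hom}(F)$-tiling, are $\mathrm{Hom}(F)$-covered, respectively. The minimum $d$-degree $\delta_d(G)$ is the largest $\ell$ such that every $d$-subset of $V(G)$ is contained in at least $\ell$ edges. For $\mathsf{X}\in\{\mathsf{Spa}_F,\mathsf{Div}_F,\mathsf{Cov}_F\}$ the threshold $\delta_d(\mathsf{X})$ is the infimum over all $\delta\in[0,1]$ such that for all $\mu>0$ and all large enough $n$ divisible by $|V(F)|$, every $n$-vertex $k$-graph $G$ with $\delta_d(G)\geq(\delta+\mu)\binom{n-d}{k-d}$ belongs to $\mathsf{X}$. *)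

(* Defs.v *)
From HB Require Import structures.
From mathcomp Require Import all_boot all_order all_algebra.
From mathcomp Require Import all_classical all_reals.

Set Implicit Arguments.
Unset Strict Implicit.
Unset Printing Implicit Defensive.
Import Order.TTheory GRing.Theory Num.Theory.

Record kgraph (k : nat) := KGraph {
  vertex :> finType;
  edges : {set {set vertex}};
  edges_uniform : forall e, e \in edges -> #|e| = k }.

Arguments edges {k} _.

Section Colourings.
Variables (k : nat) (F : kgraph k).

Definition complete_kpartite : Prop :=
  exists P : {set {set F}},
    [/\ finset.partition P [set: F], #|P| = k &
        forall e : {set F}, e \in edges F <->
          #|e| = k /\ (forall B, B \in P -> #|e :&: B| = 1)].

(* The l colours are 0, ..., l-1. The colour i is a nat so that the first two
   classes can be named before knowing that there are at least two colours. *)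
Definition colour_class l (phi : {ffun F -> 'I_l}) (i : nat) : {set F} :=
  [set x | phi x == i :> nat].

Definition proper_colouring l (phi : {ffun F -> 'I_l}) : bool :=
  [forall e in edges F, forall i : 'I_l, #|e :&: colour_class phi i| <= 1].

Definition colourable l : bool := [exists phi : {ffun F -> 'I_l}, proper_colouring phi].

Lemma colourable_card : exists l, colourable l.
Proof.
exists #|F|; apply/existsP; exists [ffun x => enum_rank x].
apply/forall_inP => e _; apply/forallP => i.
rewrite -(cards1 (enum_val i)); apply/subset_leq_card/fintype.subsetP => x.
rewrite !inE ffunE => /andP[_ /eqP/val_inj <-].
by rewrite enum_rankK.
Qed.

Definition chi : nat := ex_minn colourable_card.

(* The default value #|F| bounds the size of every class, so it does not
   affect the minimum. *)
Definition min_class_size : nat :=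
  \big[minn/#|F|]_(phi : {ffun F -> 'I_chi} | proper_colouring phi)
    \big[minn/#|F|]_(i < chi) #|colour_class phi i|.

Definition class_differences : seq nat :=
  [seq `|#|colour_class phi 0| - #|colour_class phi 1| |%N
     | phi : {ffun F -> 'I_chi} in @proper_colouring chi].

(* None stands for infinity. *)
Definition gcd_kgraph : option nat :=
  if all (pred1 0) class_differences then None
  else Some (\big[gcdn/0]_(m <- class_differences | m != 0) m).

End Colourings.

Definition tau (R : realType) (k : nat) (F : kgraph k) : R :=
  ((min_class_size F)%:R / #|F|%:R)%R.

Section Homomorphisms.
Variables (k : nat) (F G : kgraph k).

Definition is_kgraph_hom (f : {ffun F -> G}) : bool :=
  [forall e in edges F, f @: e \in edges G].

Definition kgraph_hom : finType := {f : {ffun F -> G} | is_kgraph_hom f}.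

Definition hom_fibre (phi : kgraph_hom) (v : G) : {set F} := [set x | val phi x == v].

Definition perfect_tiling (R : realType) (w : kgraph_hom -> R) : Prop :=
  forall v : G, (\sum_(phi : kgraph_hom) w phi * #|hom_fibre phi v|%:R = 1)%R.

End Homomorphisms.

Section Properties.
Variables (R : realType) (k : nat) (F : kgraph k).

Definition Spa (G : kgraph k) : Prop :=
  exists w : kgraph_hom F G -> R, perfect_tiling w /\ forall phi, (0 <= w phi <= 1)%R.

Definition Div (G : kgraph k) : Prop :=
  exists w : kgraph_hom F G -> R, perfect_tiling w /\ forall phi, w phi \is a Num.int.

Definition Cov (G : kgraph k) : Prop :=
  forall v : G, exists phi : kgraph_hom F G, #|hom_fibre phi v| = 1.

End Properties.

Section Degrees.
Variables (k d : nat).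

Definition degree (G : kgraph k) (S : {set G}) : nat :=
  #|[set e in edges G | S \subset e]|.

(* The cap #|edges G| on l only matters if G has no d-subset, when every l
   qualifies. *)
Definition min_degree (G : kgraph k) : nat :=
  \max_(l < #|edges G|.+1 | [forall (S : {set G} | #|S| == d), l <= degree S]) l.

End Degrees.

Definition threshold (R : realType) (k d : nat) (F : kgraph k)
    (X : kgraph k -> Prop) : R :=
  inf [set delta : R | (0 <= delta <= 1)%R /\
    forall mu : R, (0 < mu)%R ->
    exists n0 : nat, forall n : nat, n0 <= n -> #|F| %| n ->
    forall G : kgraph k, #|G| = n ->
      ((delta + mu) * 'C(n - d, k - d)%:R <= (min_degree d G)%:R)%R -> X G].

(* Main.v *)
(* Any two vertices of F in different parts lie in a common edge, so the proper
   k-colourings of F are the bijections from the parts to the colours. Write m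
   for |F| and a for the size of a smallest part.
   - Cov: if every (k-1)-set has degree at least 2, two edges v + S and u + S
     carry a homomorphism sending one vertex of F to v, the rest of its part to u
     and the other parts into S.
   - Div: exchanging two parts in a homomorphism onto an edge and using gcd 1
     puts e_u - e_v in the lattice of homomorphisms for all u, v in a common edge.
     As k >= 3, positive codegree puts any two vertices in a common edge, and the
     all-ones vector is congruent to |G|/m times any fixed homomorphism.
   - Spa, lower bound: if all edges meet A, the preimage of A under a homomorphism
     contains a whole part of F, so a perfect fractional tiling forces
     |A| >= (a/m)|G|; take all k-sets meeting a set A of size (a/m)|G| - 1.
   - Spa, upper bound: by Farkas' lemma it suffices that a vertex weighting that
     is nonnegative on homomorphisms has nonnegative total, which follows by
     looking at the neighbourhood of a (k-1)-set of least weight. *)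
Require Import Defs.
From mathcomp Require Import all_boot all_order all_algebra.
From mathcomp Require Import all_classical all_reals.
From mathcomp Require Import perm zify ring lra.

Set Implicit Arguments.
Unset Strict Implicit.
Unset Printing Implicit Defensive.
Import Order.TTheory GRing.Theory Num.Theory.

(** * Colourings of complete k-partite k-graphs *)

(** The partition in indexed form: [c] numbers the parts. Given [#|e| = k], the image condition says
    that [e] meets each part exactly once. *)
Definition part_labelling k (F : kgraph k) (c : {ffun F -> 'I_k}) : Prop :=
  (forall i, exists x, c x = i) /\
  forall e, e \in edges F <-> #|e| = k /\ c @: e = [set: 'I_k].

Lemma complete_kpartite_labelling k (F : kgraph k) :
  complete_kpartite F -> exists c : {ffun F -> 'I_k}, part_labelling c.
Proof.
case=> P [partP cardP edgeP].
have [/eqP covP trivP P0] := and3P partP.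
have inP x : finset.pblock P x \in P by rewrite pblock_mem // covP inE.
have ltk x : index (finset.pblock P x) (enum P) < k.
  by rewrite -[ltnRHS]cardP cardE index_mem mem_enum.
pose c := [ffun x => Ordinal (ltk x)].
pose B (i : 'I_k) := nth finset.set0 (enum P) i.
have BP i : B i \in P by rewrite -mem_enum mem_nth // -cardE cardP.
have cB i x : x \in B i -> c x = i.
  move=> xB; apply/val_inj; rewrite ffunE /= (finset.def_pblock trivP (BP i) xB).
  by rewrite index_uniq ?enum_uniq // -cardE cardP.
have Bc x : x \in B (c x).
  by rewrite /B ffunE /= nth_index ?mem_enum // mem_pblock covP inE.
have BK C : C \in P -> exists i, C = B i.
  move=> CP; have lt : index C (enum P) < k by rewrite -[ltnRHS]cardP cardE index_mem mem_enum.
  by exists (Ordinal lt); rewrite /B /= nth_index // mem_enum.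
exists c; split=> [i|e].
  have /set0Pn[x xB] : B i != finset.set0 by apply: contraNneq P0 => <-.
  by exists x; apply: cB.
rewrite edgeP; split=> -[cardE H]; split=> //.
  apply/setP => i; rewrite inE; have /eqP/cards1P[x eB] := H _ (BP i).
  have /setIP[xe xB] : x \in e :&: B i by rewrite eB inE.
  by apply/imsetP; exists x => //; rewrite (cB i).
have /imset_injP inj : #|c @: e| == #|e| by rewrite H cardsT card_ord cardE.
move=> C /BK[i ->].
have /imsetP[x xe ->] : i \in c @: e by rewrite H inE.
apply/eqP/cards1P; exists x; apply/setP => y; rewrite !inE.
apply/andP/eqP => [[ye /cB /inj ->//]|->]; split=> //.
Qed.

Lemma transversal_edge k (F : kgraph k) (c : {ffun F -> 'I_k}) (t : 'I_k -> F) :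
  part_labelling c -> cancel t c -> t @: [set: 'I_k] \in edges F.
Proof.
move=> [_ edgeP] tK; apply/edgeP; split.
  by rewrite card_imset ?cardsT ?card_ord //; apply: can_inj tK.
by rewrite -imset_comp (eq_imset (g := id)) ?imset_id //.
Qed.

Lemma labelling_section k (F : kgraph k) (c : {ffun F -> 'I_k}) :
  part_labelling c -> exists t : 'I_k -> F, cancel t c.
Proof.
move=> [surj _].
have ex i : exists x, c x == i by have [x <-] := surj i; exists x.
by exists (fun i => xchoose (ex i)) => i; apply/eqP/(xchooseP (ex i)).
Qed.

Lemma common_edge k (F : kgraph k) (c : {ffun F -> 'I_k}) (x y : F) :
  part_labelling c -> c x != c y ->
  exists2 e, e \in edges F & (x \in e) && (y \in e).
Proof.
move=> cP cxy; have [t tK] := labelling_section cP.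
pose s i := if i == c x then x else if i == c y then y else t i.
have sK : cancel s c by move=> i; rewrite /s; case: eqP => [->//|_]; case: eqP => [->//|_].
exists (s @: [set: 'I_k]); first exact: transversal_edge cP sK.
apply/andP; split; apply/imsetP.
  by exists (c x); rewrite ?inE // /s eqxx.
by exists (c y); rewrite ?inE // /s eq_sym (negbTE cxy) eqxx.
Qed.

Lemma proper_colouringP k (F : kgraph k) l (phi : {ffun F -> 'I_l}) :
  reflect (forall e, e \in edges F -> {in e &, injective phi})
          (proper_colouring phi).
Proof.
apply: (iffP forall_inP) => H e /H.
  move=> /forallP H1 x y xe ye exy.
  have /card_le1_eqP := H1 (phi x); apply; rewrite !inE ?xe ?ye ?exy //=.
move=> inj; apply/forallP => i; apply/card_le1_eqP => x y.
rewrite !inE => /andP[xe /eqP/val_inj cx] /andP[ye /eqP/val_inj cy].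
by apply: inj => //; rewrite cx cy.
Qed.

Lemma labelling_proper k (F : kgraph k) (c : {ffun F -> 'I_k}) :
  part_labelling c -> proper_colouring c.
Proof.
move=> [_ edgeP]; apply/proper_colouringP => e /edgeP[cardE ce].
by apply/imset_injP; rewrite ce cardsT card_ord cardE.
Qed.

(** The labelling itself is proper, and the [k] vertices of a transversal edge need [k] distinct
    colours. *)
Lemma chi_labelled k (F : kgraph k) (c : {ffun F -> 'I_k}) :
  part_labelling c -> chi F = k.
Proof.
move=> cP; rewrite /chi; case: ex_minnP => l /existsP[phi /proper_colouringP phiP] minl.
apply/eqP; rewrite eqn_leq minl /=; last first.
  by apply/existsP; exists c; apply: labelling_proper.
have [t tK] := labelling_section cP.
have eF := transversal_edge cP tK.
rewrite -[leqLHS](edges_uniform eF) -(card_in_imset (phiP _ eF)).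
by rewrite -[leqRHS]card_ord max_card.
Qed.

(** Vertices in different parts share an edge, so [phi] separates the parts. Its values on a
    transversal then exhaust the [k] colours, which leaves one colour for each part. *)
Lemma proper_colouring_relabel k (F : kgraph k) (c phi : {ffun F -> 'I_k}) :
  part_labelling c -> proper_colouring phi ->
  exists2 s : 'I_k -> 'I_k, injective s & forall x, phi x = s (c x).
Proof.
move=> cP /proper_colouringP phiP; have [t tK] := labelling_section cP.
have sep x y : phi x = phi y -> c x = c y.
  move=> exy; apply/eqP; apply: contraT => cxy.
  have [e eF /andP[xe ye]] := common_edge cP cxy.
  by rewrite (phiP e eF x y xe ye exy) eqxx in cxy.
have inj : injective (phi \o t) by move=> i j /sep; rewrite !tK.
exists (phi \o t) => //= x.
by have [j jK Kj] := injF_bij inj; rewrite -{1}[phi x]Kj /= -(sep _ _ (Kj (phi x))) tK.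
Qed.

Lemma colour_class_relabel k (F : kgraph k) (c phi : {ffun F -> 'I_k}) s (i : 'I_k) :
  injective s -> (forall x, phi x = s (c x)) ->
  colour_class phi (s i) = colour_class c i.
Proof.
by move=> inj phiE; apply/setP => x; rewrite !inE phiE; apply: (inj_eq inj).
Qed.

Lemma bigminn_le (I : finType) (P : pred I) (f : I -> nat) x i :
  P i -> \big[minn/x]_(j | P j) f j <= f i.
Proof. by move=> Pi; rewrite -minEnat -leEnat; apply: bigmin_le_cond. Qed.

Lemma min_class_size_le k (F : kgraph k) (c : {ffun F -> 'I_k}) (i : 'I_k) :
  part_labelling c -> min_class_size F <= #|colour_class c i|.
Proof.
move=> cP; rewrite /min_class_size (chi_labelled cP).
by apply: leq_trans (bigminn_le _ _ (labelling_proper cP)) (bigminn_le _ _ _).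
Qed.

Lemma min_class_size_attained k (F : kgraph k) (c : {ffun F -> 'I_k}) :
  0 < k -> part_labelling c ->
  exists i : 'I_k, #|colour_class c i| = min_class_size F.
Proof.
move=> k0 cP.
suff [i le] : exists i : 'I_k, #|colour_class c i| <= min_class_size F.
  by exists i; apply/eqP; rewrite eqn_leq le min_class_size_le.
(* [K] holds of the default value [#|F|] and survives [minn], so it passes through both nested
   minima. *)
pose K m := exists i : 'I_k, #|colour_class c i| <= m.
have K0 : K #|F| by exists (Ordinal k0); apply: max_card.
have Kmin a b : K a -> K b -> K (minn a b).
  by rewrite /minn; case: ltnP.
rewrite /min_class_size (chi_labelled cP).
apply: (big_ind K) => // phi phiP; apply: (big_ind K) => // i _.
have [s inj sE] := proper_colouring_relabel cP phiP.
have [j _ jK] := injF_bij inj.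
by exists (j i); rewrite -(colour_class_relabel _ inj sE) jK.
Qed.

Lemma sum_class_size k (F : kgraph k) (c : {ffun F -> 'I_k}) :
  \sum_(i < k) #|colour_class c i| = #|F|.
Proof.
rewrite -sum1_card (partition_big c xpredT) //=.
by apply: eq_bigr => i _; rewrite -sum1_card; apply: eq_bigl => x; rewrite inE.
Qed.

Lemma min_class_size_gt0 k (F : kgraph k) (c : {ffun F -> 'I_k}) :
  0 < k -> part_labelling c -> 0 < min_class_size F.
Proof.
move=> k0 cP; have [i <-] := min_class_size_attained k0 cP.
by have [x cx] := cP.1 i; apply/card_gt0P; exists x; rewrite inE cx.
Qed.

Lemma min_class_size_mul_le k (F : kgraph k) (c : {ffun F -> 'I_k}) :
  part_labelling c -> k * min_class_size F <= #|F|.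
Proof.
move=> cP; rewrite -(sum_class_size c) -{1}[k]card_ord -sum_nat_const.
by apply: leq_sum => i _; apply: min_class_size_le.
Qed.

(** An induction principle that replaces colourings by parts: classes 0 and 1 of any proper
    colouring are two distinct parts, so closure under [gcdn] leads from part-size differences to
    the gcd of the colouring differences. *)
Lemma gcd1_ind k (F : kgraph k) (c : {ffun F -> 'I_k}) (K : nat -> Prop) (lt1k : 1 < k) :
  part_labelling c -> gcd_kgraph F = Some 1 ->
  K 0 -> (forall m n, K m -> K n -> K (gcdn m n)) ->
  (forall i j : 'I_k, i != j ->
     K `|#|colour_class c i| - #|colour_class c j| |%N) ->
  K 1.
Proof.
move=> cP; rewrite /gcd_kgraph; case: ifP => // _ [<-] K0 Kgcd Kdiff.
rewrite big_seq_cond; apply: (big_ind K) => // m /andP[+ _].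
rewrite /class_differences (chi_labelled cP) => /mapP[phi].
rewrite mem_enum => phiP ->.
have [s inj sE] := proper_colouring_relabel cP phiP.
have [j _ jK] := injF_bij inj.
pose i0 := Ordinal (ltnW lt1k); pose i1 := Ordinal lt1k.
have := Kdiff (j i0) (j i1).
rewrite -!(colour_class_relabel _ inj sE) !jK /=; apply.
by rewrite (can_eq jK).
Qed.

(** * Degrees and neighbourhoods of vertex sets *)

Lemma ex_superset (T : finType) (A : {set T}) n :
  #|A| <= n <= #|T| -> exists2 B : {set T}, A \subset B & #|B| = n.
Proof.
case/andP=> An nT; rewrite -(subnKC An); set m := n - #|A|.
have : 0 < #|[set S : {set T} | (S \subset ~: A) && (#|S| == m)]|.
  rewrite cards_draws bin_gt0 cardsCs finset.setCK /m; lia.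
case/card_gt0P => S; rewrite inE => /andP[SA /eqP cS].
exists (A :|: S); first exact: finset.subsetUl.
by rewrite cardsU disjoint_setI0 ?cards0 ?subn0 ?cS // disjoint_sym finset.disjoints_subset.
Qed.

Lemma min_degree_le k d (G : kgraph k) (S : {set G}) :
  #|S| = d -> min_degree d G <= degree S.
Proof.
move=> cS; apply/bigmax_leqP => l /forallP/(_ S).
by rewrite cS eqxx.
Qed.

(** Since [d <= #|G|], some [d]-set exists, and its degree keeps [l] within the cap [#|edges G|]
    built into [min_degree]. *)
Lemma leq_min_degree k d (G : kgraph k) l :
  d <= #|G| -> (forall S : {set G}, #|S| = d -> l <= degree S) ->
  l <= min_degree d G.
Proof.
move=> dG H.
have [|S _ cS] := @ex_superset G finset.set0 d; first by rewrite cards0.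
have lt : l < #|edges G|.+1.
  rewrite ltnS (leq_trans (H S cS)) // fintype.subset_leq_card //.
  by apply/fintype.subsetP => e; rewrite inE => /andP[].
apply: (leq_bigmax_cond (Ordinal lt) (F := val)) => /=.
by apply/forall_inP => T /eqP/H.
Qed.

Definition nbhd k (G : kgraph k) (S : {set G}) : {set G} :=
  [set v | (v \notin S) && (v |: S \in edges G)].

Lemma degree_le_nbhd k (G : kgraph k.+1) (S : {set G}) :
  #|S| = k -> degree S <= #|nbhd S|.
Proof.
move=> cS; apply: leq_trans (leq_imset_card (fun v => v |: S) _).
apply/fintype.subset_leq_card/fintype.subsetP => e; rewrite inE => /andP[eG Se].
have : #|e :\: S| == 1.
  by rewrite cardsD (finset.setIidPr Se) cS (edges_uniform eG) subSnn.
case/cards1P => v ev.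
have vS : v \in e :\: S by rewrite ev inE.
have eE : e = v |: S by rewrite -ev finset.setUC -{1}(setID e S) (finset.setIidPr Se).
apply/imsetP; exists v => //; rewrite inE -eE eG andbT.
by move: vS; rewrite inE => /andP[].
Qed.

(** * Covering and integral tilings *)

(** Labels the edge formed by [v] and the image of [g] with [v] in the prescribed position [i0];
    nesting it prescribes two positions. *)
Definition star_map r (G : Type) (v : G) (g : 'I_r -> G) (i0 i : 'I_r.+1) : G :=
  if unlift i0 i is Some j then g j else v.

Lemma star_map_imset r (G : finType) (v : G) (g : 'I_r -> G) i0 :
  star_map v g i0 @: [set: 'I_r.+1] = v |: g @: [set: 'I_r].
Proof.
apply/setP => z; rewrite !inE; apply/imsetP/orP => [[i _ ->]|[/eqP->|/imsetP[j _ ->]]].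
- rewrite /star_map; case: unliftP => [j _|_]; last by left.
  by right; apply: imset_f; rewrite inE.
- by exists i0; rewrite ?inE // /star_map unlift_none.
- by exists (lift i0 j); rewrite ?inE // /star_map liftK.
Qed.

Lemma enum_set_ord (T : finType) (S : {set T}) r :
  #|S| = r -> exists2 g : 'I_r -> T, injective g & g @: [set: 'I_r] = S.
Proof.
move=> <-; exists enum_val; first exact: enum_val_inj.
apply/setP => z; apply/imsetP/idP => [[j _ ->]|zS]; first exact: enum_valP.
by exists (enum_rank_in zS z); rewrite ?inE // enum_rankK_in.
Qed.

(** Every edge of [F] carries all labels, so [h \o c] sends each of them onto the same edge of
    [G]. *)
Lemma labelling_hom k (F G : kgraph k) (c : {ffun F -> 'I_k}) (h : 'I_k -> G) :
  part_labelling c -> h @: [set: 'I_k] \in edges G ->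
  exists phi : kgraph_hom F G, forall x, val phi x = h (c x).
Proof.
move=> [_ edgeP] hG.
have homP : is_kgraph_hom [ffun x => h (c x)].
  apply/forall_inP => e /edgeP[_ ce].
  rewrite (eq_imset (g := h \o c)); last by move=> x; rewrite ffunE.
  by rewrite imset_comp ce.
by exists (Sub _ homP : kgraph_hom F G) => x; rewrite SubK ffunE.
Qed.

Lemma edge_superset r (G : kgraph r.+2) (A : {set G}) :
  #|A| <= r.+1 <= #|G| ->
  (forall S : {set G}, #|S| = r.+1 -> 0 < degree S) ->
  exists2 e, e \in edges G & A \subset e.
Proof.
move=> /ex_superset[S AS cS] deg; have := deg S cS.
case/card_gt0P => e; rewrite inE => /andP[eG Se].
by exists e => //; apply: fintype.subset_trans Se.
Qed.

Lemma Cov_of_codegree r (F G : kgraph r.+2) (c : {ffun F -> 'I_r.+2}) :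
  part_labelling c -> r.+1 <= #|G| ->
  (forall S : {set G}, #|S| = r.+1 -> 1 < degree S) -> Cov F G.
Proof.
move=> cP rG deg v.
have [||e eG] := @edge_superset _ G [set v]; first by rewrite cards1.
  by move=> S /deg /ltnW.
rewrite finset.sub1set => ve.
have cS : #|e :\ v| = r.+1.
  by have := edges_uniform eG; rewrite (cardsD1 v) ve => -[].
have vN : v \in nbhd (e :\ v) by rewrite inE !inE eqxx /= finset.setD1K.
have := leq_trans (deg _ cS) (degree_le_nbhd cS).
rewrite (cardsD1 v) vN => /card_gt0P[u].
rewrite !inE => /and3P[uv /negP uS ueG].
have [g ginj gS] := enum_set_ord cS.
have [x0 cx0] := cP.1 ord0.
(* Only [x0] goes to [v]; the rest of its part, labelled [ord0], goes to [u], and the other parts go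
   into [e :\ v]. *)
pose f := [ffun x => if x == x0 then v else star_map u g ord0 (c x)].
have homP : is_kgraph_hom f.
  apply/forall_inP => e' e'F.
  have cinj : {in e' &, injective c}.
    exact: (proper_colouringP _ (labelling_proper cP)) e'F.
  have [_ ce'] := (cP.2 e').1 e'F.
  (* An edge through [x0] has no other vertex labelled [ord0], so its image is [e]; any other edge
     goes onto [u |: (e :\ v)]. *)
  case: (boolP (x0 \in e')) => x0e.
    rewrite (eq_in_imset (g := star_map v g ord0 \o c)) => [|x xe].
      by rewrite imset_comp ce' star_map_imset gS finset.setD1K.
    rewrite ffunE /= /star_map; case: eqP => [->|xx0]; first by rewrite cx0 unlift_none.
    case: unliftP => // cx; case: xx0; apply: cinj => //.
    by rewrite cx cx0.
  rewrite (eq_in_imset (g := star_map u g ord0 \o c)) => [|x xe].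
    by rewrite imset_comp ce' star_map_imset gS.
  by rewrite ffunE /=; case: eqP => // xx0; rewrite -xx0 xe in x0e.
exists (Sub _ homP : kgraph_hom F G); apply/eqP/cards1P; exists x0; apply/setP => x.
rewrite !inE SubK ffunE; case: (x =P x0) => _; first by rewrite eqxx.
rewrite /star_map; case: unliftP => [j _|_]; last exact/negbTE.
have : g j \in e :\ v by rewrite -gS; apply: imset_f; rewrite inE.
by rewrite !inE => /andP[/negbTE].
Qed.

(** * The lattice of integral tilings *)

Section IntegralTilings.
Local Open Scope ring_scope.

(** Membership in the lattice spanned by the fibre-size vectors of homomorphisms; [Div] asks that it
    contain the all-ones vector. *)
Definition int_tiled (R : realType) k (F G : kgraph k) (x : G -> R) : Prop :=
  exists w : kgraph_hom F G -> R, (forall phi, w phi \is a Num.int) /\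
    forall v, \sum_phi w phi * #|hom_fibre phi v|%:R = x v.

Lemma int_tiled_ext (R : realType) k (F G : kgraph k) (x y : G -> R) :
  (forall v, x v = y v) -> int_tiled F x -> int_tiled F y.
Proof. by move=> xy [w [wint wx]]; exists w; split=> // v; rewrite wx. Qed.

Lemma int_tiled_comb (R : realType) k (F G : kgraph k) (a b : R) (x y : G -> R) :
  a \is a Num.int -> b \is a Num.int -> int_tiled F x -> int_tiled F y ->
  int_tiled F (fun v => a * x v + b * y v).
Proof.
move=> aint bint [w [wint wx]] [w' [w'int w'y]].
exists (fun phi => a * w phi + b * w' phi); split=> [phi|v].
  by rewrite rpredD ?rpredM.
rewrite -wx -w'y !mulr_sumr -big_split; apply: eq_bigr => phi _ /=; ring.
Qed.

Lemma int_tiled0 (R : realType) k (F G : kgraph k) : @int_tiled R k F G (fun=> 0).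
Proof.
exists (fun=> 0); split=> [phi|v]; first exact: rpred0.
by rewrite big1 // => phi _; rewrite mul0r.
Qed.

Lemma int_tiled_sum (R : realType) k (F G : kgraph k) (I : finType)
    (a : I -> R) (x : I -> G -> R) :
  (forall i, a i \is a Num.int) -> (forall i, int_tiled F (x i)) ->
  int_tiled F (fun v => \sum_i a i * x i v).
Proof.
move=> aint xint.
suff H (s : seq I) : int_tiled F (fun v => \sum_(i <- s) a i * x i v) by apply: H.
elim: s => [|i s IHs].
  by apply: int_tiled_ext (int_tiled0 R F G) => v; rewrite big_nil.
apply: int_tiled_ext (int_tiled_comb (aint i) (rpred1 _) (xint i) IHs) => v.
by rewrite big_cons mul1r.
Qed.

Lemma int_tiled_hom (R : realType) k (F G : kgraph k) (phi : kgraph_hom F G) :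
  int_tiled F (fun v => #|hom_fibre phi v|%:R : R).
Proof.
exists (fun psi => (psi == phi)%:R); split=> [psi|v]; first exact: rpred_nat.
rewrite (bigD1 phi) //= eqxx mul1r big1 ?addr0 // => psi /negbTE->.
by rewrite mul0r.
Qed.

Lemma card_labelled_fibre k (F G : kgraph k) (c : {ffun F -> 'I_k}) (h : 'I_k -> G)
    (phi : kgraph_hom F G) (v : G) :
  (forall x, val phi x = h (c x)) ->
  #|hom_fibre phi v| = (\sum_i (h i == v) * #|colour_class c i|)%N.
Proof.
move=> phiE; rewrite -sum1_card big_mkcond (partition_big c xpredT) //=.
apply: eq_bigr => i _; rewrite -sum1_card big_distrr /=.
apply: eq_big => [x|x /eqP <-]; first by rewrite inE.
by rewrite inE phiE muln1; case: eqP.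
Qed.

(* Exchanging the images of the parts i and j in a homomorphism onto an edge
   moves |class i| - |class j| units of weight from v to u. *)
Lemma int_tiled_swap (R : realType) k (F G : kgraph k) (c : {ffun F -> 'I_k})
    (h : 'I_k -> G) (i j : 'I_k) :
  part_labelling c -> h @: [set: 'I_k] \in edges G -> i != j ->
  int_tiled F (fun v => (#|colour_class c i|%:R - #|colour_class c j|%:R)
                        * ((h i == v)%:R - (h j == v)%:R) : R).
Proof.
move=> cP hG ij.
pose h' := h \o tperm i j.
have h'G : h' @: [set: 'I_k] \in edges G.
  rewrite imset_comp (_ : tperm i j @: [set: 'I_k] = [set: 'I_k]) //.
  apply/setP => z; rewrite !inE; apply/imsetP; exists (tperm i j z); rewrite ?inE //.
  by rewrite tpermK.
have [phi phiE] := labelling_hom cP hG.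
have [psi psiE] := labelling_hom cP h'G.
apply: int_tiled_ext (int_tiled_comb (rpred1 _) (rpredN1 _)
  (int_tiled_hom R phi) (int_tiled_hom R psi)) => v.
rewrite (card_labelled_fibre v phiE) (card_labelled_fibre v psiE).
have split (g : 'I_k -> G) : (\sum_z (g z == v) * #|colour_class c z| =
    (g i == v) * #|colour_class c i| + ((g j == v) * #|colour_class c j| +
     \sum_(z | (z != i) && (z != j)) (g z == v) * #|colour_class c z|))%N.
  by rewrite (bigD1 i) //= (bigD1 j) //= eq_sym.
rewrite !split /h' /= tpermL tpermR.
rewrite [X in _ + -1 * (_ + (_ + X))%:R]
  (eq_bigr (fun z => (h z == v) * #|colour_class c z|)%N).
  by rewrite !natrD !natrM; ring.
by move=> z /andP[zi zj]; rewrite /= tpermD // eq_sym.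
Qed.
End IntegralTilings.

Section Divisibility.
Local Open Scope ring_scope.

(** The multiples [m] for which [K m] holds contain the part-size differences, by swaps, and are
    closed under gcd, by Bezout; hence they contain 1. *)
Lemma int_tiled_edge (R : realType) r (F G : kgraph r.+2) (c : {ffun F -> 'I_r.+2})
    (e : {set G}) (u v : G) :
  part_labelling c -> gcd_kgraph F = Some 1%N -> e \in edges G ->
  u \in e -> v \in e -> u != v ->
  int_tiled F (fun z => (u == z)%:R - (v == z)%:R : R).
Proof.
move=> cP gcd1 eG ue ve uv.
pose K m := int_tiled F (fun z => m%:R * ((u == z)%:R - (v == z)%:R) : R).
suff : K 1%N by apply: int_tiled_ext => z; rewrite mul1r.
apply: (gcd1_ind (c := c)) => // [|m n Km Kn|i j ij].
- by apply: int_tiled_ext (int_tiled0 R F G) => z; rewrite mul0r.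
- have [a [b ab]] := Bezoutz m n.
  apply: int_tiled_ext (int_tiled_comb (intr_int R a) (intr_int R b) Km Kn) => z.
  have <- : a%:~R * m%:R + b%:~R * n%:R = (gcdn m n)%:R :> R.
    by rewrite -[RHS]/((gcdz m n)%:~R) -ab intrD !intrM.
  ring.
have c2 : #|e :\ u :\ v| = r.
  have := edges_uniform eG; rewrite (cardsD1 u) ue (cardsD1 v) !inE eq_sym uv ve.
  by case.
have [g _ gS] := enum_set_ord c2.
have /unlift_some[j' jE _] := ij.
pose h := star_map u (star_map v g j') i.
have hG : h @: [set: 'I_r.+2] \in edges G.
  by rewrite !star_map_imset gS !finset.setD1K // !inE eq_sym uv.
have hi : h i = u by rewrite /h /star_map unlift_none.
have hj : h j = v by rewrite /h jE /star_map liftK unlift_none.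
have := int_tiled_swap R cP hG ij; rewrite hi hj => T.
(* The swap yields the signed difference, whereas [K] needs its absolute value; in the negative case
   the vector is negated. *)
have [le|/ltnW le] := leqP #|colour_class c j| #|colour_class c i|.
  apply: int_tiled_ext T => z; by rewrite distnEl // natrB.
apply: int_tiled_ext (int_tiled_comb (rpredN1 _) (rpred0 _) T T) => z.
by rewrite mul0r addr0 mulN1r -mulNr opprB distnEr // natrB.
Qed.

Lemma sum_hom_fibre k (F G : kgraph k) (phi : kgraph_hom F G) :
  (\sum_v #|hom_fibre phi v|)%N = #|F|.
Proof.
rewrite -sum1_card (partition_big (val phi) xpredT) //=.
by apply: eq_bigr => v _; rewrite -sum1_card; apply: eq_bigl => x; rewrite inE.
Qed.

Lemma Div_of_codegree (R : realType) r (F G : kgraph r.+3) (c : {ffun F -> 'I_r.+3}) :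
  part_labelling c -> gcd_kgraph F = Some 1%N -> (r.+2 <= #|G|)%N ->
  (#|F| %| #|G|)%N ->
  (forall S : {set G}, #|S| = r.+2 -> (0 < degree S)%N) -> Div R F G.
Proof.
move=> cP gcd1 rG /dvdnP[N GE] deg.
(* A pair of vertices extends to a set of size [r.+2], hence to an edge; this is where uniformity at
   least 3 enters. *)
have diff (u v : G) : int_tiled F (fun z => (u == z)%:R - (v == z)%:R : R).
  have [->|uv] := eqVneq u v.
    by apply: int_tiled_ext (int_tiled0 R F G) => z; rewrite subrr.
  have [|//|e eG] := @edge_superset _ G [set u; v]; first by rewrite cards2 uv.
  rewrite finset.subUset !finset.sub1set => /andP[ue ve].
  exact: (int_tiled_edge R cP gcd1 eG ue ve uv).
have [|//|e eG _] := @edge_superset _ G finset.set0; first by rewrite cards0.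
have [g _ ge] := enum_set_ord (edges_uniform eG).
have [|phi _] := @labelling_hom _ F G c g cP; first by rewrite ge.
pose v0 := g ord0.
pose f v : R := #|hom_fibre phi v|%:R.
have sumf : \sum_v f v = #|F|%:R by rewrite -natr_sum sum_hom_fibre.
(* The coefficients [1 - N * f v] sum to [#|G| - N * #|F| = 0], so the [v0] terms cancel and the
   vector is [1 - N * f]. Adding [N * f] gives the all-ones vector. *)
have T1 : int_tiled F (fun z => \sum_v (1 - N%:R * f v) * ((v == z)%:R - (v0 == z)%:R) : R).
  by apply: int_tiled_sum => // v; rewrite rpredB ?rpredM ?rpred_nat ?rpred1.
have [w [wint wE]] := int_tiled_comb (rpred1 _) (rpred_nat _ N) T1 (int_tiled_hom R phi).
exists w; split=> // z; rewrite wE mul1r -/(f z).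
have delta (a : G -> R) : \sum_v a v * (v == z)%:R = a z.
  rewrite (bigD1 z) //= eqxx mulr1 big1 ?addr0 // => v /negbTE->.
  by rewrite mulr0.
under eq_bigr do rewrite mulrBr.
rewrite sumrB delta -mulr_suml sumrB sumr_const -mulr_sumr sumf.
rewrite -[#|_|%:R]/(#|G|%:R) GE natrM; ring.
Qed.
End Divisibility.

(** * Fractional tilings *)

Section Farkas.
Local Open Scope ring_scope.

(* Bartl's induction on the number of constraints: if A ord0 is indispensable,
   there is x0 with A ord0 . x0 = 1 satisfying the other constraints with
   c . x0 > 0, and one projects along x0. *)
Lemma farkas_ord (R : realFieldType) (V : finType) n (A : 'I_n -> V -> R) (c : V -> R) :
  (forall x : V -> R, (forall i, \sum_v A i v * x v <= 0) -> \sum_v c v * x v <= 0) ->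
  exists2 u : 'I_n -> R, (forall i, 0 <= u i) & forall v, c v = \sum_i u i * A i v.
Proof.
elim: n A c => [|n IHn] A c H.
  exists (fun=> 0) => // v; rewrite big_ord0.
  (* Without constraints, testing [c] against itself forces a sum of squares to vanish. *)
  have : \sum_v c v * c v <= 0 by apply: H => -[].
  rewrite le_eqVlt ltNge sumr_ge0 => [|w _]; last by rewrite -expr2 sqr_ge0.
  rewrite orbF psumr_eq0 => [|w _]; last by rewrite -expr2 sqr_ge0.
  by move=> /allP/(_ v); rewrite mem_index_enum mulf_eq0 orbb => /(_ isT)/eqP.
pose dot (a x : V -> R) := \sum_v a v * x v.
pose B j := A (lift ord0 j).
have splitB (P : 'I_n.+1 -> Prop) : P ord0 -> (forall j, P (lift ord0 j)) -> forall i, P i.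
  by move=> P0 Pj i; case: (unliftP ord0 i) => [j ->|->]; [apply: Pj | apply: P0].
have [Hrest|] := pselect (forall x, (forall j, dot (B j) x <= 0) -> dot c x <= 0).
  have [u u0 uc] := IHn B c Hrest.
  exists (fun i => if unlift ord0 i is Some j then u j else 0).
    by move=> i; case: unlift.
  move=> v; rewrite big_ord_recl unlift_none mul0r add0r uc.
  by apply: eq_bigr => j _; rewrite liftK.
move=> /existsNP[x1 /not_implyP[x1B /negP]]; rewrite -ltNge => cx1.
have dotZ a t x : dot a (fun v => t * x v) = t * dot a x.
  by rewrite /dot mulr_sumr; apply: eq_bigr => v _; rewrite mulrCA.
have dotB a x y t : dot a (fun v => x v - t * y v) = dot a x - t * dot a y.
  rewrite /dot mulr_sumr -sumrB; apply: eq_bigr => v _; ring.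
have dotBl a b x t : dot (fun v => a v - t * b v) x = dot a x - t * dot b x.
  rewrite /dot mulr_sumr -sumrB; apply: eq_bigr => v _; ring.
have Ax1 : 0 < dot (A ord0) x1.
  rewrite ltNge; apply: contraTN cx1 => Ax1; rewrite -leNgt.
  by apply: H; apply: splitB => [|j]; [exact: Ax1 | exact: x1B].
pose x0 v := (dot (A ord0) x1)^-1 * x1 v.
have A0x0 : dot (A ord0) x0 = 1 by rewrite dotZ mulVf // gt_eqF.
have Bx0 j : dot (B j) x0 <= 0 by rewrite dotZ pmulr_rle0 ?invr_gt0.
have cx0 : 0 < dot c x0 by rewrite dotZ mulr_gt0 ?invr_gt0.
(* Evaluating a projected functional at [x] amounts to evaluating the original one at
   [x - (A ord0 . x) x0], where [A ord0] vanishes. *)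
have [|u u0 uc] := IHn (fun j v => B j v - dot (B j) x0 * A ord0 v)
                      (fun v => c v - dot c x0 * A ord0 v).
  move=> x Hx; rewrite -/(dot _ x) dotBl mulrC -dotB; apply: H; apply: splitB => [|j].
    by rewrite -/(dot _ _) dotB A0x0 mulr1 subrr.
  by rewrite -/(dot _ _) dotB mulrC -dotBl; apply: Hx.
(* The coefficient of [A ord0] collects the projection terms; it is nonnegative because [c . x0 > 0]
   and each [B j . x0 <= 0]. *)
exists (fun i => if unlift ord0 i is Some j then u j
                 else dot c x0 - \sum_j u j * dot (B j) x0).
  move=> i; case: unlift => // .
  rewrite subr_ge0 (le_trans _ (ltW cx0)) // sumr_le0 // => j _.
  by rewrite mulr_ge0_le0.
move=> v; rewrite big_ord_recl unlift_none.
rewrite [X in _ = _ + X](eq_bigr (fun j => u j * B j v)) => [|j _]; last by rewrite liftK.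
have := uc v; under [in X in _ = X -> _]eq_bigr do rewrite mulrBr mulrA.
by rewrite sumrB -mulr_suml => /eqP; rewrite subr_eq => /eqP ->; ring.
Qed.

Lemma farkas (R : realFieldType) (I V : finType) (A : I -> V -> R) (c : V -> R) :
  (forall x : V -> R, (forall i, \sum_v A i v * x v <= 0) -> \sum_v c v * x v <= 0) ->
  exists2 u : I -> R, (forall i, 0 <= u i) & forall v, c v = \sum_i u i * A i v.
Proof.
move=> H; have [x Hx|u u0 uc] := @farkas_ord R V #|I| (fun i => A (enum_val i)) c.
  by apply: H => i; have := Hx (enum_rank i); rewrite enum_rankK.
exists (fun i => u (enum_rank i)) => // v; rewrite uc.
rewrite (reindex _ (onW_bij _ (@enum_rank_bij I))).
by apply: eq_bigr => i _; rewrite enum_rankK.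
Qed.
End Farkas.

Section FractionalTilings.
Local Open Scope ring_scope.

(* Average, over the cyclic shifts t of S, of the homomorphisms sending a
   smallest part to v and the other parts bijectively to S. *)
Lemma edge_weight_ge0 (R : realFieldType) r (F G : kgraph r.+2)
    (c : {ffun F -> 'I_r.+2}) (y : G -> R) (S : {set G}) (v : G) :
  part_labelling c -> (forall phi : kgraph_hom F G, 0 <= \sum_x y (val phi x)) ->
  #|S| = r.+1 -> v |: S \in edges G ->
  0 <= (min_class_size F)%:R * (r.+1%:R * y v) +
       (#|F|%:R - (min_class_size F)%:R) * \sum_(u in S) y u.
Proof.
move=> cP y0 cS vS.
have [i0 <-] := min_class_size_attained (ltn0Sn _) cP.
have [g ginj gS] := enum_set_ord cS.
pose m i : R := #|colour_class c i|%:R.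
(* Addition on the ordinals is modulo [r.+1], so over all shifts [t] each position runs through [S]
   exactly once. *)
have sumS (a : 'I_r.+1) : \sum_(t < r.+1) y (g (a + t)) = \sum_(u in S) y u.
  rewrite -(reindex_inj (h := fun t => a + t) (P := xpredT) (F := fun t => y (g t)));
    last exact: addrI.
  rewrite -gS big_imset /= => [|? ? _ _ /ginj//].
  by apply: eq_bigl => t; rewrite inE.
have shift t : 0 <= m i0 * y v + \sum_j m (lift i0 j) * y (g (j + t)).
  have [|phi phiE] := @labelling_hom _ F G c (star_map v (fun j => g (j + t)) i0) cP.
    have shiftT : (fun j : 'I_r.+1 => j + t) @: [set: 'I_r.+1] = [set: 'I_r.+1].
      by apply/setP => z; rewrite inE; apply/imsetP; exists (z - t); rewrite ?inE ?subrK.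
    by rewrite star_map_imset (imset_comp g (fun j => j + t)) shiftT gS.
  apply: le_trans (y0 phi) _.
  rewrite (partition_big c xpredT) //= (bigD1_ord i0) //=.
  have part i : \sum_(x | c x == i) y (val phi x) =
      m i * y (star_map v (fun j => g (j + t)) i0 i).
    rewrite mulr_natl -sumr_const; apply: eq_big => [x|x /eqP <-].
      by rewrite inE.
    by rewrite phiE.
  rewrite part /star_map unlift_none lerD2l ler_sum // => j _.
  by rewrite part /star_map liftK.
have : 0 <= \sum_(t < r.+1) (m i0 * y v + \sum_j m (lift i0 j) * y (g (j + t))).
  by apply: sumr_ge0 => t _; apply: shift.
rewrite big_split /= sumr_const card_ord exchange_big /=.
rewrite (eq_bigr (fun j => m (lift i0 j) * \sum_(u in S) y u)); last first.
  by move=> j _; rewrite -mulr_sumr sumS.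
rewrite -mulr_suml -mulrnAr -[y v *+ _]mulr_natl.
rewrite (_ : \sum_j m (lift i0 j) = #|F|%:R - m i0) //.
by rewrite -(sum_class_size c) (bigD1_ord i0) // natrD addrAC subrr add0r natr_sum.
Qed.

(* S has minimum weight s among the (k-1)-sets, so every vertex outside S weighs
   at least s/(k-1), while its neighbours weigh at least -(m-a)s/((k-1)a) by the
   previous lemma, where m = |F| and a is the size of a smallest part. *)
Lemma total_weight_ge0 (R : realFieldType) r (F G : kgraph r.+2)
    (c : {ffun F -> 'I_r.+2}) (y : G -> R) :
  part_labelling c -> (forall phi : kgraph_hom F G, 0 <= \sum_x y (val phi x)) ->
  (r.+1 <= #|G|)%N ->
  (forall S : {set G}, #|S| = r.+1 ->
     (min_class_size F * #|G| <= #|F| * degree S)%N) ->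
  0 <= \sum_v y v.
Proof.
move=> cP y0 rG deg.
have [|S0 _ cS0] := @ex_superset G finset.set0 r.+1; first by rewrite cards0.
have S0r : #|S0| == r.+1 by apply/eqP.
case: (@Order.TotalTheory.arg_minP _ R _ S0 (fun S : {set G} => #|S| == r.+1)
  (fun S : {set G} => \sum_(u in S) y u) S0r) => S /eqP cS minS.
set s := \sum_(u in S) y u in minS.
(* Otherwise replacing [u] by [v] would give a lighter set than [S]. *)
have exch v u : v \notin S -> u \in S -> y u <= y v.
  move=> vS uS; have := minS (v |: (S :\ u)).
  have vSu : v \notin S :\ u by rewrite !inE (negbTE vS) andbF.
  rewrite cardsU1 vSu; have := cS; rewrite (cardsD1 u) uS => ->.
  move=> /(_ (eqxx _)); rewrite big_setU1 //= /s (big_setD1 u) //=.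
  by rewrite lerD2r.
have out v : v \notin S -> s <= r.+1%:R * y v.
  move=> vS; rewrite mulr_natl -cS -sumr_const; apply: ler_sum => u uS.
  exact: exch.
set a := min_class_size F; set m := #|F|.
have a0 : 0 < a%:R :> R by rewrite ltr0n (min_class_size_gt0 _ cP).
have nb v : v \in nbhd S -> - ((m%:R - a%:R) * s) <= a%:R * (r.+1%:R * y v).
  rewrite inE => /andP[vS vSG].
  by rewrite -subr_ge0 opprK; apply: edge_weight_ge0 cP y0 cS vSG.
set D := nbhd S.
have DS : D \subset ~: S by apply/fintype.subsetP => v; rewrite !inE => /andP[].
have cSC : #|~: S| = (#|G| - r.+1)%N by rewrite cardsCs finset.setCK cS.
have splitG (f : G -> R) :
    \sum_v f v = \sum_(v in S) f v + (\sum_(v in D) f v + \sum_(v in ~: S :\: D) f v).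
  rewrite (bigID (mem S)) /=; congr (_ + _).
  rewrite (eq_bigl (fun v => v \in ~: S)) => [|v]; last by rewrite inE.
  by rewrite (big_setID D) /= (finset.setIidPr DS).
have [s0|s0] := leP 0 s.
  rewrite (bigID (mem S)) /= addr_ge0 // sumr_ge0 // => v vS.
  by rewrite -(@pmulr_rge0 _ r.+1%:R) ?ltr0n // (le_trans s0 (out v vS)).
(* Multiplying the total by [a * r.+1] clears the denominators of the bounds on single vertices. *)
have ar0 : 0 < a%:R * r.+1%:R :> R by rewrite mulr_gt0 ?ltr0Sn.
rewrite -(pmulr_rge0 _ ar0) mulr_sumr splitG.
have -> : \sum_(v in S) a%:R * r.+1%:R * y v = a%:R * r.+1%:R * s by rewrite -mulr_sumr.
have sumD : #|D|%:R * - ((m%:R - a%:R) * s) <= \sum_(v in D) a%:R * r.+1%:R * y v.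
  rewrite mulr_natl -sumr_const ler_sum // => v /nb.
  by rewrite mulrA.
have sumE : #|~: S :\: D|%:R * (a%:R * s) <= \sum_(v in ~: S :\: D) a%:R * r.+1%:R * y v.
  rewrite mulr_natl -sumr_const ler_sum // => v; rewrite !inE => /andP[_ /out].
  by rewrite -mulrA ler_pM2l.
apply: le_trans (lerD (lexx _) (lerD sumD sumE)).
have -> : #|~: S :\: D|%:R = #|G|%:R - r.+1%:R - #|D|%:R :> R.
  rewrite cardsD (finset.setIidPr DS) natrB; last first.
    exact: fintype.subset_leq_card.
  by rewrite cSC natrB.
have degD : a%:R * #|G|%:R <= m%:R * #|D|%:R :> R.
  rewrite -!natrM ler_nat (leq_trans (deg S cS)) // leq_mul2l.
  by rewrite degree_le_nbhd ?orbT.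
(* The lower bounds on the three pieces add up to a product of two nonnegative factors, by [degD]
   and [s < 0]. *)
rewrite (_ : _ + _ = (m%:R * #|D|%:R - a%:R * #|G|%:R) * - s); last by ring.
by rewrite mulr_ge0 ?oppr_ge0 ?subr_ge0 // ltW.
Qed.

Lemma Spa_of_codegree (R : realType) r (F G : kgraph r.+2) (c : {ffun F -> 'I_r.+2}) :
  part_labelling c -> (r.+1 <= #|G|)%N ->
  (forall S : {set G}, #|S| = r.+1 ->
     (min_class_size F * #|G| <= #|F| * degree S)%N) ->
  Spa R F G.
Proof.
move=> cP rG deg.
(* The constraints are the fibre-size vectors and the target is the all-ones vector; the weighting
   to test is [- x]. *)
have [x Hx|w w0 wE] := @farkas R (kgraph_hom F G) G
    (fun phi v => #|hom_fibre phi v|%:R) (fun=> 1).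
  rewrite -oppr_ge0 -sumrN.
  under eq_bigr do rewrite mul1r.
  apply: (total_weight_ge0 cP) => // phi.
  rewrite (partition_big (val phi) xpredT) //=.
  rewrite (eq_bigr (fun v => - (#|hom_fibre phi v|%:R * x v))) => [|v _].
    by rewrite sumrN oppr_ge0.
  rewrite -mulrN mulr_natl -sumr_const.
  by apply: eq_big => [z|z /eqP->]; rewrite ?inE.
exists w; split=> [v|phi]; first by rewrite -wE.
rewrite w0 /=; have [z _] := cP.1 ord0.
(* At an image vertex of [phi] the fibre is non-empty and the nonnegative terms sum to 1, so
   [w phi <= 1]. *)
rewrite [leRHS](wE (val phi z)) (bigD1 phi) //=.
apply: ler_wpDr; first by apply: sumr_ge0 => psi _; rewrite mulr_ge0 ?w0.
rewrite ler_peMr ?w0 // ler1n; apply/card_gt0P.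
by exists z; rewrite inE.
Qed.

(** If no part were mapped inside [A], choosing from each part a vertex mapped outside [A] would
    give an edge whose image misses [A]. *)
Lemma min_class_size_hom k (F G : kgraph k) (c : {ffun F -> 'I_k}) (A : {set G})
    (phi : kgraph_hom F G) :
  part_labelling c -> (0 < k)%N -> (forall e, e \in edges G -> e :&: A != finset.set0) ->
  (min_class_size F <= \sum_(v in A) #|hom_fibre phi v|)%N.
Proof.
move=> cP k0 cover.
have -> : (\sum_(v in A) #|hom_fibre phi v| = #|[set x | val phi x \in A]|)%N.
  rewrite -sum1_card (partition_big (val phi) (mem A)) => [|x]; last by rewrite inE.
  apply: eq_bigr => v vA; rewrite -sum1_card; apply: eq_bigl => x; rewrite !inE.
  by case: eqP => [->|]; rewrite ?andbT ?andbF // inE.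
have [/existsP[i /fintype.subsetP ci]|] :=
    boolP [exists i : 'I_k, colour_class c i \subset [set x | val phi x \in A]].
  apply: leq_trans (min_class_size_le i cP) _.
  by apply/fintype.subset_leq_card/fintype.subsetP.
rewrite negb_exists => /forallP avoid.
have ex i : exists x, (c x == i) && (val phi x \notin A).
  have /fintype.subsetPn[x] := avoid i.
  by rewrite !inE => /eqP/val_inj cx xA; exists x; rewrite cx eqxx.
pose t i := xchoose (ex i).
have tK : cancel t c by move=> i; have /andP[/eqP] := xchooseP (ex i).
have /cover/set0Pn[v] := forall_inP (valP phi) _ (transversal_edge cP tK).
rewrite inE => /andP[/imsetP[x /imsetP[i _ ->] ->]].
by have /andP[_ /negbTE->] := xchooseP (ex i).
Qed.

(** Double counting: the total weight times [#|F|] is [#|G|], while the total weight times the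
    smallest part size is at most [#|A|]. *)
Lemma not_Spa_of_cover (R : realType) k (F G : kgraph k) (c : {ffun F -> 'I_k})
    (A : {set G}) :
  part_labelling c -> (0 < k)%N -> (forall e, e \in edges G -> e :&: A != finset.set0) ->
  (#|F| * #|A| < min_class_size F * #|G|)%N -> ~ Spa R F G.
Proof.
move=> cP k0 cover small [w [wE w01]].
have sumG : \sum_phi w phi * #|F|%:R = #|G|%:R.
  rewrite -[RHS]sumr_const.
  rewrite (eq_bigr (fun v => \sum_phi w phi * #|hom_fibre phi v|%:R)) => [|v _];
    last by rewrite wE.
  rewrite exchange_big /=.
  apply: eq_bigr => phi _; rewrite -mulr_sumr -natr_sum.
  by rewrite sum_hom_fibre.
have sumA : \sum_phi w phi * (min_class_size F)%:R <= #|A|%:R.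
  rewrite -[leRHS]sumr_const.
  rewrite (eq_bigr (fun v => \sum_phi w phi * #|hom_fibre phi v|%:R)) => [|v _];
    last by rewrite wE.
  rewrite exchange_big /=.
  apply: ler_sum => phi _; rewrite -mulr_sumr -natr_sum.
  have /andP[w0 _] := w01 phi.
  by rewrite ler_wpM2l // ler_nat (min_class_size_hom _ cP).
move: small; rewrite -(ltr_nat R) !natrM -sumG ltNge => /negP; apply.
apply: le_trans (ler_wpM2l (ler0n _ _) sumA).
by rewrite -!mulr_suml mulrCA [leRHS]mulrCA [_%:R * _]mulrC.
Qed.

(** * The extremal construction for the lower bound *)

Definition cover_edges k (V : finType) (A : {set V}) : {set {set V}} :=
  [set e : {set V} | (#|e| == k) && (e :&: A != finset.set0)].

Lemma cover_edges_uniform k (V : finType) (A : {set V}) e :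
  e \in cover_edges k A -> #|e| = k.
Proof. by rewrite inE => /andP[/eqP]. Qed.

Definition cover_kgraph k (V : finType) (A : {set V}) : kgraph k :=
  KGraph (@cover_edges_uniform k V A).

(** If [S] misses [A], each vertex of [A] completes [S] to an edge; if [S] meets [A], every vertex
    outside [S] does, and there are at least [#|A|] of these. *)
Lemma cover_kgraph_degree r (V : finType) (A S : {set V}) :
  #|S| = r -> (#|A| + r <= #|V|)%N -> (#|A| <= @degree _ (cover_kgraph r.+1 A) S)%N.
Proof.
move=> cS AV.
have deg (D : {set V}) : {in D, forall v, (v \notin S) && ((v |: S) :&: A != finset.set0)} ->
    (#|D| <= @degree _ (cover_kgraph r.+1 A) S)%N.
  move=> HD; rewrite -(card_in_imset (f := fun v => v |: S)) => [|u v /HD/andP[uS _] _ uv].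
    apply/fintype.subset_leq_card/fintype.subsetP => e /imsetP[v /HD/andP[vS vA] ->].
    by rewrite !inE vA cardsU1 vS cS eqxx finset.subsetUr.
  have : u \in v |: S by rewrite -uv !inE eqxx.
  by rewrite !inE (negbTE uS) orbF => /eqP.
have [SA|/set0Pn[z]] := eqVneq (S :&: A) finset.set0.
  apply: deg => v vA; apply/andP; split.
    by apply/negP => vS; have := finset.in_set0 v; rewrite -SA inE vS vA.
  by apply/set0Pn; exists v; rewrite !inE eqxx.
rewrite inE => /andP[zS zA].
apply: leq_trans (deg (~: S) _).
  by rewrite [#|~: S|]cardsCs finset.setCK cS; lia.
move=> v; rewrite inE => ->; apply/set0Pn; exists z.
by rewrite !inE zS orbT.
Qed.
End FractionalTilings.

(** * Thresholds *)

Section Thresholds.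
Local Open Scope ring_scope.

(** The first family of hypotheses puts [t] in the set defining the infimum and the second excludes
    every smaller [delta]. In codimension one the binomial coefficient is just [#|G| - k]. *)
Lemma threshold_eq (R : realType) k (F : kgraph k.+1) (X : kgraph k.+1 -> Prop) (t : R) :
  0 <= t <= 1 ->
  (forall mu : R, 0 < mu -> exists n0 : nat, forall G : kgraph k.+1, (n0 <= #|G|)%N ->
     (#|F| %| #|G|)%N ->
     (forall S : {set G}, #|S| = k -> (t + mu) * (#|G| - k)%:R <= (degree S)%:R) ->
     X G) ->
  (forall delta : R, 0 <= delta < t -> exists2 mu : R, 0 < mu &
     forall n0 : nat, exists G : kgraph k.+1,
     [/\ (n0 <= #|G|)%N, (#|F| %| #|G|)%N,
       (delta + mu) * (#|G| - k)%:R <= (min_degree k G)%:R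
       & ~ X G]) ->
  threshold R k F X = t.
Proof.
move=> t01 upper lower; rewrite /threshold subSnn.
set E := (X in inf X).
have Elb : lbound E t.
  move=> d [/andP[d0 d1] Hd]; rewrite leNgt; apply/negP => dt.
  have [|mu mu0 low] := lower d; first by rewrite d0.
  have [n0 Hn0] := Hd mu mu0; have [G [nG FG degG]] := low n0.
  by apply; apply: (Hn0 #|G|) => //; rewrite bin1.
have Et : E t.
  split=> // mu mu0; have [n0 Hn0] := upper mu mu0; exists n0 => n n0n Fn G Gn.
  rewrite bin1 -Gn => degG; apply: Hn0; rewrite ?Gn // -?Gn // => S cS.
  by apply: le_trans degG _; rewrite ler_nat min_degree_le.
apply/eqP; rewrite eq_le; apply/andP; split.
  by apply: ge_inf => //; exists t.
by apply: lb_le_inf Elb; exists t.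
Qed.

Lemma archi_mul_ge (R : realType) (x y : R) : 0 < y ->
  exists n0 : nat, forall n, (n0 <= n)%N -> x <= y * n%:R.
Proof.
move=> y0; have [//|xy0] := leP 0 (x / y).
  move=> /archi_boundP/ltW H; exists (Num.bound (x / y)) => n le.
  rewrite mulrC -ler_pdivrMr //; apply: le_trans H _; by rewrite ler_nat.
exists 0%N => n _; apply: (@le_trans _ _ 0).
  by rewrite -(@pmulr_lle0 _ y^-1) ?invr_gt0 ?ltW.
by rewrite mulr_ge0 ?ler0n ?ltW.
Qed.

Lemma threshold_eq0 (R : realType) k (F : kgraph k.+1) (X : kgraph k.+1 -> Prop) :
  (forall G : kgraph k.+1, (k <= #|G|)%N -> (#|F| %| #|G|)%N ->
     (forall S : {set G}, #|S| = k -> (1 < degree S)%N) -> X G) ->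
  threshold R k F X = 0.
Proof.
move=> HX; apply: threshold_eq => [|mu mu0|d]; first by rewrite lexx ler01.
  (* Any positive density forces codegree at least 2 once [#|G| - k >= n0]; the lower-bound
     condition is vacuous at 0. *)
  have [n0 Hn0] := @archi_mul_ge R 2 mu mu0.
  exists (n0 + k)%N => G nG FG deg; apply: HX => // [|S cS]; first by lia.
  rewrite -(ler_nat R); apply: le_trans (deg S cS); rewrite add0r.
  by apply: Hn0; lia.
by move=> /andP[d0 /(le_lt_trans d0)]; rewrite ltxx.
Qed.

Lemma threshold_Spa (R : realType) r (F : kgraph r.+2) (c : {ffun F -> 'I_r.+2}) :
  part_labelling c -> threshold R r.+1 F (Spa R F) = tau R F.
Proof.
move=> cP; set a := min_class_size F; set m := #|F|.
have a0 : (0 < a)%N := min_class_size_gt0 (ltn0Sn _) cP.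
have am : (r.+2 * a <= m)%N := min_class_size_mul_le cP.
have m0 : (0 < m)%N by nia.
have mR : 0 < m%:R :> R by rewrite ltr0n.
have tauE : tau R F * m%:R = a%:R by rewrite /tau mulfVK ?gt_eqF.
have tau0 : 0 <= tau R F by rewrite divr_ge0 ?ler0n.
have tau1 : tau R F <= 1.
  by rewrite ler_pdivrMr // mul1r ler_nat -/a -/m; nia.
apply: threshold_eq => [|mu mu0|d /andP[d0 dt]]; first by rewrite tau0.
  (* The slack [mu * (#|G| - r.+1)] must absorb [tau * r.+1], the gap between [tau * #|G|] and
     [tau * (#|G| - r.+1)]. *)
  have [n0 Hn0] := archi_mul_ge (tau R F * r.+1%:R) mu0.
  exists (n0 + r.+1)%N => G nG FG deg; apply: (Spa_of_codegree R cP) => [|S cS].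
    by lia.
  rewrite -(ler_nat R) !natrM -tauE mulrAC mulrC ler_pM2l //.
  apply: le_trans (deg S cS); rewrite mulrDl.
  have := Hn0 (#|G| - r.+1)%N; rewrite leq_subRL; last by lia.
  rewrite natrB; last by lia.
  by rewrite addnC nG => /(_ isT); lra.
(* Half the gap gives [d + mu = tau - mu]; the spare [mu * n >= 1] pays for the vertex missing from
   [A]. *)
have mu0 : 0 < (tau R F - d) / 2 by lra.
exists ((tau R F - d) / 2) => // n0; set mu := _ / 2 in mu0 *.
have [N0 HN0] := @archi_mul_ge R 1 _ mu0.
pose N := (maxn n0 N0).+1; pose n := (N * m)%N.
have nn0 : (n0 <= n)%N by rewrite /n /N; nia.
have nN0 : (N0 <= n)%N by rewrite /n /N; nia.
(* Here [N * a] equals [tau * n]; one vertex fewer makes the counting inequality strict. *)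
have [|A _ cA] := @ex_superset 'I_n finset.set0 (N * a).-1.
  by rewrite cards0 card_ord /n; nia.
have An : (#|A| + r.+1 <= n)%N by rewrite cA /n /N; nia.
pose G := cover_kgraph r.+2 A; exists G.
have cG : #|G| = n by rewrite card_ord.
rewrite cG; split=> //; first by rewrite dvdn_mull.
  apply: (@le_trans _ _ (#|A|%:R : R)); last first.
    rewrite ler_nat leq_min_degree ?cG //; first by lia.
    by move=> S cS; apply: cover_kgraph_degree; rewrite ?card_ord.
  rewrite cA -subn1 [leRHS]natrB; last by nia.
  have HN := HN0 n nN0.
  have -> : (N * a)%:R = tau R F * n%:R :> R by rewrite !natrM -tauE; ring.
  have nk : (n - r.+1)%:R <= n%:R :> R by rewrite ler_nat leq_subr.
  apply: le_trans (ler_wpM2l _ nk) _; first by rewrite addr_ge0 // ltW.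
  by rewrite (_ : d + mu = tau R F - mu) ?mulrBl ?lerD2l ?lerN2 // /mu; field.
apply: (not_Spa_of_cover (A := A : {set G}) cP) => //.
  by move=> e; rewrite inE => /andP[].
by rewrite cA cG /n -/a -/m; nia.
Qed.
End Thresholds.

Theorem proposition4p6 (R : realType) (k : nat) (hk : (3 <= k)%N)
    (F : kgraph k) (hF : complete_kpartite F)
    (hgcd : gcd_kgraph F = Some 1%N) :
  [/\ threshold R (k - 1) F (Spa R F) = tau R F,
      threshold R (k - 1) F (Div R F) = 0%R &
      threshold R (k - 1) F (Cov F) = 0%R].
Proof.
case: k hk F hF hgcd => [|[|[|r]]] // _ F hF hgcd; rewrite subn1 /=.
have [c cP] := complete_kpartite_labelling hF; split.
- exact: threshold_Spa cP.
- apply: threshold_eq0 => G rG FG deg.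
  by apply: (Div_of_codegree R cP) => // S /deg /ltnW.
- by apply: threshold_eq0 => G rG _; apply: Cov_of_codegree cP rG.
Qed.
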